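(* Let $\lambda=(\lambda_1\ge \lambda_2\ge\cdots\ge\lambda_{\ell}>0)$ be a partition and let $m\ge 0$ be an integer. Let $\mathrm{PP}(\lambda;m)$ denote the set of plane partitions of shape $\lambda$ with entries between $0$ and $m$ inclusive. Then \[ \sum_{P\in \mathrm{PP}(\lambda;m)} x^{\#\{\text{rows of }P\text{ containing an entry equal to }0\}} \;=\; \sum_{P\in \mathrm{PP}(\lambda;m)} x^{\#\{\text{rows of }P\text{ containing an entry equal to }m\}}, \] as polynomials in $x$.
   Context: A plane partition of shape $\lambda$ is a filling of the Young diagram of $\lambda$ (with $\lambda_i$ cells in row $i$) by nonnegative integers that are weakly decreasing along each row (left to right) and along each column (top to bottom). *)

(* Defs.v *)
From mathcomp Require Import all_boot all_order all_algebra.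

Set Implicit Arguments.
Unset Strict Implicit.
Unset Printing Implicit Defensive.

Definition is_partition (la : seq nat) : bool :=
  sorted geq la && all (fun k => 0 < k) la.

(* Cells of the Young diagram, rows and columns numbered from 0. *)
Notation cell la := {i : 'I_(size la) & 'I_(nth 0 la i)}.

Section PlanePartitions.

Variables (la : seq nat) (m : nat).

Definition cell_row (c : cell la) : nat := tag c.
Definition cell_col (c : cell la) : nat := tagged c.

(* The entries, being of type 'I_m.+1, are the integers between 0 and m. *)
Definition filling := {ffun cell la -> 'I_m.+1}.

Definition weakly_decreasing_rows (P : filling) : bool :=
  [forall c : cell la, forall d : cell la,
    (cell_row c == cell_row d) && (cell_col c <= cell_col d)
      ==> (P d <= P c)].

Definition weakly_decreasing_cols (P : filling) : bool :=
  [forall c : cell la, forall d : cell la,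
    (cell_col c == cell_col d) && (cell_row c <= cell_row d)
      ==> (P d <= P c)].

Definition PP : {set {ffun cell la -> 'I_m.+1}} :=
  [set P | weakly_decreasing_rows P & weakly_decreasing_cols P].

Definition rows_containing (v : nat) (P : filling) : nat :=
  #|[set i : 'I_(size la) |
      [exists c : cell la, (tag c == i) && (P c == v :> nat)]]|.

End PlanePartitions.

(* Main.v *)
(* For 0 <= j <= la_1, let the j-th statistic count the rows i in which the
   entries in columns j' - 1 and j' agree, where j' = min(j, la_i); here column
   -1 is filled with m and every row is followed by 0.  It is the number of rows
   containing m for j = 0, and of rows containing 0 for j = la_1.  The j-th and
   (j+1)-st statistics are equidistributed already when all columns but the j-th
   are fixed: if a and b are the columns to its left and right, this says that
   among the weakly decreasing c with b <= c <= a pointwise, the number of i with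
   c_i = a_i and the number of i with c_i = b_i have the same distribution.  Let
   l(s) and r(s) be the two generating functions restricted to c_0 <= s; then
   l(s) = (1 - x) r(s + 1) + x r(s) for s >= b_0, by induction on the length, and
   for s >= a_0 the restriction is void, so r(s + 1) = r(s) and l = r. *)
Require Import Defs.
From mathcomp Require Import all_boot all_order all_algebra.
From mathcomp Require Import zify ring.
Import GRing.Theory.

Set Implicit Arguments.
Unset Strict Implicit.
Unset Printing Implicit Defensive.

(** * Generating functions of one column between two fixed columns *)

Section ColumnSums.

Variables (R : comNzRingType) (x : R).

(** With [f := a] this is l(s), with [f := b] it is r(s). The first value [c] becomes the cap for
    the rest of the column. *)
Fixpoint column_sum (k : nat) (f a b : nat -> nat) (s : nat) : R :=
  if k is k'.+1 then
    (\sum_(b 0 <= c < (minn (a 0) s).+1)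
       x ^+ (c == f 0) * column_sum k' (f \o S) (a \o S) (b \o S) c)%R
  else 1%R.

Lemma column_sum_cap k f a b s :
  a 0 <= s -> column_sum k f a b s = column_sum k f a b (a 0).
Proof. by case: k => // k le_as /=; rewrite (minn_idPl le_as) minnn. Qed.

(** Since [u] grows by [h n] at each [n > b], raising [s] adds the same term to both sides. At
    [s = b] the weight of the lowest value fits because [(1 - x) * x + x * x = x]. *)
Lemma telescoping_sum (h : nat -> R) b s : b <= s ->
  let u n := (\sum_(b <= c < n) x ^+ (c == b) * h c)%R in
  (\sum_(b <= c < s.+1) ((1 - x) * h c.+1 + x * h c) =
     (1 - x) * u s.+2 + x * u s.+1)%R.
Proof.
move=> le_bs u.
have uS n : b < n -> u n.+1 = (u n + h n)%R.
  by move=> lt_bn; rewrite /u big_nat_recr 1?ltnW //= gtn_eqF // expr0 mul1r.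
have u1 : u b.+1 = (x * h b)%R by rewrite /u big_nat1 eqxx expr1.
elim: s le_bs => [|s IH] le_bs.
  move: le_bs u1 uS; rewrite leqn0 => /eqP-> u1 uS.
  by rewrite big_nat1 uS // u1; ring.
move: le_bs; rewrite leq_eqVlt => /orP[/eqP <- | lt_bs].
  by rewrite big_nat1 uS // u1; ring.
rewrite big_nat_recr 1?ltnW //= IH // (uS s.+2) ?(uS s.+1) //; last by lia.
by ring.
Qed.

Lemma column_sum_shift k a b s :
    (forall i, a i.+1 <= a i) -> (forall i, b i.+1 <= b i) ->
    (forall i, b i <= a i) -> b 0 <= s ->
  column_sum k a a b s =
    ((1 - x) * column_sum k b a b s.+1 + x * column_sum k b a b s)%R.
Proof.
elim: k a b s => [|k IH] a b s a_dec b_dec le_ba le_bs /=; first by ring.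
set h := column_sum k (b \o S) (a \o S) (b \o S).
have step c : b 0 <= c -> column_sum k (a \o S) (a \o S) (b \o S) c =
    ((1 - x) * h c.+1 + x * h c)%R.
  move=> le_bc; apply: IH => [i|i|i|] /=; rewrite ?a_dec ?b_dec ?le_ba //.
  exact: leq_trans (b_dec 0) le_bc.
(* If [s < a 0], no first value reaches [a 0], so every weight on the left is 1 and the sum
   telescopes as it stands. *)
have [lt_sa | le_as] := ltnP s (a 0).
  have -> : minn (a 0) s.+1 = s.+1 by lia.
  rewrite -telescoping_sum //.
  apply: eq_big_nat => c /andP[le_bc lt_cs].
  by rewrite step // ltn_eqF ?expr0 ?mul1r // (leq_trans lt_cs).
(* Otherwise both terms on the right coincide and their coefficients add up to 1; on the left the
   value [c = a 0] is split off. *)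
have -> : minn (a 0) s.+1 = a 0 by lia.
rewrite -mulrDl addrNK mul1r big_nat_recr ?le_ba //= eqxx expr1 step ?le_ba //.
(* The tail is bounded by [a 1 <= a 0], so the larger cap admits nothing new. *)
have -> : h (a 0).+1 = h (a 0).
  by rewrite /h column_sum_cap ?[RHS]column_sum_cap //= ?a_dec // leqW ?a_dec.
rewrite -mulrDl addrNK mul1r.
have -> : (\sum_(b 0 <= c < a 0) x ^+ (c == a 0) *
     column_sum k (a \o S) (a \o S) (b \o S) c =
   \sum_(b 0 <= c < a 0) ((1 - x) * h c.+1 + x * h c))%R.
  apply: eq_big_nat => c /andP[le_bc lt_ca].
  by rewrite step // ltn_eqF ?expr0 ?mul1r.
have := le_ba 0; rewrite leq_eqVlt => /orP[/eqP <- | lt_ba].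
  by rewrite big_nat1 big_geq // eqxx expr1 add0r.
rewrite [RHS]big_nat_recr 1?ltnW //= gtn_eqF //.
(* The values below [a 0] telescope with cap [a 0 - 1]. *)
case: (a 0) lt_ba => // a0 lt_ba.
rewrite telescoping_sum // big_nat_recr 1?ltnW //= gtn_eqF // expr0.
by ring.
Qed.

Lemma column_sum_sym k a b m :
    (forall i, a i.+1 <= a i) -> (forall i, b i.+1 <= b i) ->
    (forall i, b i <= a i) -> a 0 <= m ->
  column_sum k a a b m = column_sum k b a b m.
Proof.
move=> a_dec b_dec le_ba le_am.
rewrite column_sum_shift // ?(leq_trans (le_ba 0)) //.
rewrite (@column_sum_cap _ _ _ _ m.+1) 1?leqW // (@column_sum_cap _ _ _ _ m) //.
by ring.
Qed.

Fixpoint between (a b : nat -> nat) (s : nat) (c : seq nat) : bool :=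
  if c is y :: c' then
    [&& b 0 <= y, y <= a 0, y <= s & between (a \o S) (b \o S) y c']
  else true.

(** Prepending [s] turns the cap into one more instance of monotonicity; the default 0 makes the
    inequalities past the end trivial. *)
Lemma betweenP a b s c :
  reflect ((forall i, i < size c -> b i <= nth 0 c i <= a i) /\
           (forall i, nth 0 (s :: c) i.+1 <= nth 0 (s :: c) i))
          (between a b s c).
Proof.
elim: c a b s => [|y c IH] a b s /=.
  by left; split=> // -[|i] //=; rewrite nth_nil.
apply: (iffP and4P) => [[le_by le_ya le_ys /IH[bnd dec]] | [bnd dec]].
  by split=> [[|i] lt_ic|[|i]] //=; rewrite ?le_by ?bnd // dec.
have /andP[-> ->] := bnd 0 isT; have /= -> := dec 0; split=> //.
by apply/IH; split=> [i lt_ic|i]; [apply: bnd i.+1 _|apply: dec i.+1].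
Qed.

Lemma big_tuple_recl (T : finType) k (p : pred (k.+1.-tuple T))
    (F : k.+1.-tuple T -> R) :
  (\sum_(t : k.+1.-tuple T | p t) F t =
   \sum_(y : T) \sum_(t : k.-tuple T | p [tuple of y :: t])
     F [tuple of y :: t])%R.
Proof.
rewrite pair_big_dep /=.
rewrite (reindex (fun q : T * k.-tuple T => [tuple of q.1 :: q.2])) //=.
exists (fun t => (thead t, [tuple of behead t])) => [[y t] _ | t _] /=.
  by congr (_, _); apply: val_inj.
by rewrite -tuple_eta.
Qed.

(** The cap [s <= m] keeps every value of the recursion inside ['I_m.+1], so summing over tuples
    loses nothing. *)
Lemma column_sumE m k (f : nat -> nat) a b s : s <= m ->
  (\sum_(t : k.-tuple 'I_m.+1 | between a b s (map val t))
     x ^+ (\sum_(i < k) (nth 0 (map val t) i == f i))%N)%R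
  = column_sum k f a b s.
Proof.
elim: k f a b s => [|k IH] f a b s le_sm /=.
  rewrite (big_pred1 [tuple]) ?big_ord0 ?expr0 // => t.
  by rewrite [t]tuple0 /= eqxx.
rewrite big_tuple_recl.
transitivity (\sum_(y < m.+1 | ((b 0 <= y) && (y < (minn (a 0) s).+1))%N)
   x ^+ (y == f 0 :> nat) * column_sum k (f \o S) (a \o S) (b \o S) y)%R.
  rewrite [RHS]big_mkcond; apply: eq_bigr => y _.
  rewrite ltnS leq_min; case: ifP => [/and3P[le_by le_ya le_ys] | nP].
    rewrite -IH -1?ltnS // big_distrr /=.
    apply: eq_big => [t|t _]; first by rewrite le_by le_ya le_ys.
    by rewrite big_ord_recl exprD.
  by apply: big_pred0 => t /=; rewrite !andbA -(andbA (b 0 <= y)) nP.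
rewrite big_geq_mkord /= (big_ord_widen_cond m.+1 (leq (b 0)) (fun y =>
  x ^+ (y == f 0) * column_sum k (f \o S) (a \o S) (b \o S) y)%R) //.
by rewrite ltnS geq_min le_sm orbT.
Qed.

End ColumnSums.

Lemma noninc_le (f : nat -> nat) : (forall i, f i.+1 <= f i) ->
  forall i k, i <= k -> f k <= f i.
Proof.
move=> f_dec i k /subnKC <-; elim: (k - i) => [|d IH]; first by rewrite addn0.
by rewrite addnS (leq_trans (f_dec _)).
Qed.

(** * Plane partitions as functions on all pairs of indices, and the statistics *)

Section Cells.

Variables (la : seq nat) (m : nat).

Lemma cell_col_lt (c : cell la) : cell_col c < nth 0 la (cell_row c).
Proof. exact: ltn_ord. Qed.

Lemma cell_inj (c d : cell la) :
  cell_row c = cell_row d -> cell_col c = cell_col d -> c = d.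
Proof.
case: c d => [i u] [i' v]; rewrite /cell_row /cell_col /=.
by move/val_inj=> eq_i; move: v; rewrite -{i'}eq_i => v /val_inj ->.
Qed.

Lemma cell_ex i j : j < nth 0 la i ->
  exists c : cell la, cell_row c = i /\ cell_col c = j.
Proof.
move=> lt_j; have lt_i : i < size la.
  by rewrite ltnNge; apply/negP => le_i; rewrite nth_default in lt_j.
by exists (Tagged (fun i : 'I_(size la) => 'I_(nth 0 la i))
  (Ordinal (lt_j : j < nth 0 la (Ordinal lt_i)))).
Qed.

(** Extension by 0 outside the diagram, so that neighbouring entries can be compared without
    membership proofs. *)
Definition entry (P : filling la m) (i j : nat) : nat :=
  if [pick c : cell la | (cell_row c == i) && (cell_col c == j)] is Some c
  then P c else 0.

Lemma entry_cell P c : entry P (cell_row c) (cell_col c) = P c.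
Proof.
rewrite /entry; case: pickP => [d /andP[/eqP er /eqP ec]|/(_ c)].
  by rewrite (cell_inj er ec).
by rewrite !eqxx.
Qed.

Lemma entry_out P i j : nth 0 la i <= j -> entry P i j = 0.
Proof.
move=> le_j; rewrite /entry; case: pickP => // d /andP[/eqP er /eqP ec].
by have := cell_col_lt d; rewrite er ec ltnNge le_j.
Qed.

Lemma entry_le P i j : entry P i j <= m.
Proof. by rewrite /entry; case: pickP => // c _; rewrite -ltnS. Qed.

Lemma entry_inj P Q : (forall i j, entry P i j = entry Q i j) -> P = Q.
Proof.
by move=> eqPQ; apply/ffunP => c; apply: val_inj; rewrite /= -!entry_cell.
Qed.

(* Column index [j] stands for column [j - 1]; the virtual column to the left
   of the diagram is filled with [m]. *)
Definition lentry (P : filling la m) (i j : nat) : nat :=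
  if j is j'.+1 then entry P i j' else m.

Lemma lentry_le P i j : lentry P i j <= m.
Proof. by case: j => //= j; apply: entry_le. Qed.

Lemma lentryE P i j :
  lentry P i j = if 0 < j then entry P i j.-1 else m.
Proof. by case: j. Qed.

Hypothesis hla : is_partition la.

Lemma la_noninc i : nth 0 la i.+1 <= nth 0 la i.
Proof.
have [lt_i | le_i] := ltnP i.+1 (size la); last by rewrite nth_default.
by case/andP: hla => /(sortedP 0)/(_ _ lt_i).
Qed.

Lemma la_gt0 i : i < size la -> 0 < nth 0 la i.
Proof. by move=> lt_i; case/andP: hla => _ /all_nthP; apply. Qed.

(** Adjacent comparisons suffice by transitivity. They hold trivially when the smaller entry lies
    outside the diagram; when it lies inside, so does the other one, as row lengths decrease. *)
Lemma PP_entryP P :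
  reflect ((forall i j, entry P i j.+1 <= entry P i j) /\
           (forall i j, entry P i.+1 j <= entry P i j)) (P \in PP la m).
Proof.
rewrite inE; apply: (iffP andP) => [[/forallP Hr /forallP Hc] | [Hr Hc]].
  split=> i j.
    have [lt_j | le_j] := ltnP j.+1 (nth 0 la i); last by rewrite entry_out.
    have [c [rc cc]] := cell_ex (ltnW lt_j); have [d [rd cd]] := cell_ex lt_j.
    have /forallP/(_ d) := Hr c; rewrite -!entry_cell rc cc rd cd.
    by rewrite eqxx leqnSn.
  have [lt_j | le_j] := ltnP j (nth 0 la i.+1); last by rewrite entry_out.
  have [c [rc cc]] := cell_ex (leq_trans lt_j (la_noninc i)).
  have [d [rd cd]] := cell_ex lt_j.
  have /forallP/(_ d) := Hc c; rewrite -!entry_cell rc cc rd cd.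
  by rewrite eqxx leqnSn.
split; apply/forallP => c; apply/forallP => d; apply/implyP => /andP[/eqP e le];
  rewrite -!entry_cell e.
  exact: (noninc_le (Hr _)).
exact: (noninc_le (fun i => Hc i _)).
Qed.

(** The j-th statistic. Once [j] has passed the end of a row, the truncation keeps comparing its
    last entry with the 0 behind it. *)
Definition agreements (j : nat) (P : filling la m) : nat :=
  \sum_(i < size la) (let j' := minn j (nth 0 la i) in
                      entry P i j' == lentry P i j').

Lemma rows_containingE v (P : filling la m) :
  rows_containing v P =
  \sum_(i < size la) [exists c : cell la, (tag c == i) && (P c == v :> nat)].
Proof.
rewrite /rows_containing cardsE -sum1_card big_mkcond; apply: eq_bigr => i _.
by rewrite unfold_in; case: ifP.
Qed.

(** Entries are at most [m] and decrease along the row, so a row contains [m] exactly when its first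
    entry is [m]. *)
Lemma agreements_first P : P \in PP la m ->
  rows_containing m P = agreements 0 P.
Proof.
case/PP_entryP => Hr _; rewrite rows_containingE; apply: eq_bigr => i _.
rewrite min0n /=; congr (nat_of_bool _).
apply/existsP/eqP => [[c /andP[/eqP <- /eqP Pc]] | eq_m].
  apply/eqP; rewrite eqn_leq entry_le -{1}Pc -entry_cell.
  exact: (noninc_le (Hr _)).
have [c [rc cc]] := cell_ex (la_gt0 (ltn_ord i)).
exists c; rewrite -entry_cell rc cc eq_m eqxx andbT.
by apply/eqP/val_inj.
Qed.

(** A row contains 0 exactly when its last entry, which exists because rows are nonempty, equals the
    0 behind it. *)
Lemma agreements_last j P : (forall i, nth 0 la i <= j) -> P \in PP la m ->
  rows_containing 0 P = agreements j P.
Proof.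
move=> le_j /PP_entryP[Hr _]; rewrite rows_containingE; apply: eq_bigr => i _.
have -> : minn j (nth 0 la i) = nth 0 la i by apply/minn_idPr.
rewrite /= entry_out //; congr (nat_of_bool _).
have lt0 := la_gt0 (ltn_ord i); case E: (nth 0 la i) lt0 => [//|n] _ /=.
apply/existsP/eqP => [[c /andP[/eqP eq_i /eqP Pc]] | eq_0].
  apply/eqP; rewrite eq_sym -leqn0 -Pc -entry_cell /cell_row eq_i.
  apply: (noninc_le (Hr _)); have := cell_col_lt c.
  by rewrite /cell_row eq_i E.
have [|c [rc cc]] := @cell_ex i n; first by rewrite E.
exists c; rewrite -entry_cell rc cc -eq_0 eqxx andbT.
by apply/eqP/val_inj.
Qed.

(** * Varying column [j] while the others stay fixed *)

Section ReplaceColumn.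

Variable j : nat.

Definition col_len : nat := count (ltn j) la.

(** Row lengths decrease, so the rows that reach column [j] form an initial segment. *)
Lemma lt_col_len i : (i < col_len) = (j < nth 0 la i).
Proof.
rewrite /col_len; case/andP: hla => + _; elim: la i => [|y s IH] i /=.
  by rewrite nth_nil.
move=> sorted_s; case: (ltnP j y) => [lt_j | le_j].
  by case: i => [|i] //=; rewrite add1n ltnS IH ?(path_sorted sorted_s).
rewrite add0n; have /allP s_le : all (geq y) s.
  by apply: order_path_min sorted_s => a b c; apply: (fun x y => leq_trans y x).
rewrite (@eq_in_count _ _ pred0) ?count_pred0 => [|z /s_le]; last first.
  by rewrite /= => le_z; apply/negbTE; rewrite -leqNgt (leq_trans le_z).
symmetry; apply/negbTE; rewrite -leqNgt; case: i => [|i] //=.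
have [lt_i | le_i] := ltnP i (size s); last by rewrite nth_default.
by rewrite (leq_trans (s_le _ (mem_nth 0 lt_i))).
Qed.

Lemma col_len_le : col_len <= size la.
Proof. exact: count_size. Qed.

Definition set_col (P : filling la m) (t : col_len.-tuple 'I_m.+1) :
    filling la m :=
  [ffun c => if cell_col c == j then nth ord0 t (cell_row c) else P c].

Lemma entry_set_col P t i k :
  entry (set_col P t) i k =
    if k == j then nth 0 (map val t) i else entry P i k.
Proof.
have [lt_k | le_k] := ltnP k (nth 0 la i).
  have [c [<- <-]] := cell_ex lt_k; rewrite !entry_cell ffunE.
  case: eqP => // eq_j; rewrite (nth_map ord0) // size_tuple lt_col_len -eq_j.
  exact: cell_col_lt.
rewrite !entry_out //; case: eqP le_k => // -> le_j.
by rewrite nth_default // size_map size_tuple leqNgt lt_col_len -leqNgt.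
Qed.

Definition get_col (P : filling la m) : col_len.-tuple 'I_m.+1 :=
  [tuple inord (entry P i j) | i < col_len].

Lemma nth_get_col P i : nth 0 (map val (get_col P)) i = entry P i j.
Proof.
have [lt_i | le_i] := ltnP i col_len; last first.
  rewrite nth_default; last by rewrite size_map (size_tuple (get_col P)).
  by rewrite entry_out // leqNgt -lt_col_len -leqNgt.
rewrite (nth_map ord0) ?size_tuple //.
rewrite -[i]/(nat_of_ord (Ordinal lt_i)) -tnth_nth tnth_mktuple /= inordK //.
by rewrite ltnS entry_le.
Qed.

Lemma get_set_col P t : get_col (set_col P t) = t.
Proof.
apply: val_inj; apply: (inj_map val_inj); apply: (@eq_from_nth _ 0).
  by rewrite !size_map -enumT size_enum_ord size_tuple.
by move=> i _; rewrite nth_get_col entry_set_col eqxx.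
Qed.

Lemma set_set_col P t u : set_col (set_col P t) u = set_col P u.
Proof. by apply/ffunP => c; rewrite !ffunE; case: (_ == j). Qed.

Lemma set_get_col P : set_col P (get_col P) = P.
Proof.
apply: entry_inj => i k; rewrite entry_set_col.
by case: eqP => // ->; rewrite nth_get_col.
Qed.

(** Only inequalities that involve column [j] are at stake: those with the two adjacent columns give
    the bounds, those inside the column give monotonicity. *)
Lemma set_col_PP P t : P \in PP la m ->
  (set_col P t \in PP la m) =
  between (lentry P ^~ j) (entry P ^~ j.+1) m (map val t).
Proof.
move=> /PP_entryP[Hr Hc].
have t_le i : nth 0 (map val t) i <= m.
  have [lt_i | le_i] := ltnP i (size t); last by rewrite nth_default ?size_map.
  by rewrite (nth_map ord0) //; apply: leq_ord.
(* Below the foot of column [j], it and the column to its right are both 0. *)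
have out i : ~~ (i < size (map val t)) ->
    nth 0 (map val t) i = 0 /\ entry P i j.+1 = 0.
  rewrite -leqNgt => le_i; split; first by rewrite nth_default.
  rewrite entry_out // leqW // leqNgt -lt_col_len -leqNgt.
  by move: le_i; rewrite size_map size_tuple.
apply/PP_entryP/betweenP => [[Tr Tc] | [bnd dec]]; split.
- move=> i _; have := Tr i j; rewrite !entry_set_col eqxx gtn_eqF // => -> /=.
  rewrite lentryE; case: ifP => [j_gt0 | _]; last exact: t_le.
  by have := Tr i j.-1; rewrite prednK // !entry_set_col eqxx ltn_eqF ?prednK.
- move=> [|i]; first by rewrite /= t_le.
  by have := Tc i j; rewrite !entry_set_col eqxx.
- move=> i k; rewrite !entry_set_col; have [-> | ne_kj] := eqVneq k j.
    rewrite gtn_eqF //; have [lt_i | /out[-> ->] //] := boolP (i < size (map val t)).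
    by case/andP: (bnd i lt_i).
  have [eq_j | _] := eqVneq k.+1 j; last exact: Hr.
  have [lt_i | /out[-> _] //] := boolP (i < size (map val t)).
  by case/andP: (bnd i lt_i); rewrite -eq_j.
- move=> i k; rewrite !entry_set_col; case: eqP => _; last exact: Hc.
  exact: dec i.+1.
Qed.

(** The share of the rows that do not reach column [j]: it is the same in statistics [j] and [j + 1]
    and does not depend on column [j]. *)
Definition fixed_agreements (P : filling la m) : nat :=
  \sum_(col_len <= i < size la) (0 == lentry P i (nth 0 la i)).

Lemma lentry_set_col P t i k : k <= j -> lentry (set_col P t) i k = lentry P i k.
Proof. by case: k => //= k lt_kj; rewrite entry_set_col ltn_eqF. Qed.

Lemma agreements_split k P : j <= k <= j.+1 ->
  agreements k P =
    \sum_(i < col_len) (entry P i k == lentry P i k) + fixed_agreements P.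
Proof.
case/andP=> le_jk le_kj; rewrite /agreements /=.
rewrite -(big_mkord predT (fun i => let k' := minn k (nth 0 la i) in
  nat_of_bool (entry P i k' == lentry P i k'))).
rewrite (big_cat_nat _ col_len_le) //= big_mkord; congr (_ + _).
  apply: eq_bigr => i _; have := ltn_ord i; rewrite lt_col_len => lt_j.
  by have -> : minn k (nth 0 la i) = k by lia.
apply: eq_big_nat => i /andP[le_i _].
rewrite leqNgt lt_col_len -leqNgt in le_i.
by rewrite (minn_idPr (leq_trans le_i le_jk)) entry_out.
Qed.

Lemma fixed_agreements_set_col P t :
  fixed_agreements (set_col P t) = fixed_agreements P.
Proof.
apply: eq_big_nat => i /andP[le_i _]; rewrite lentry_set_col //.
by rewrite leqNgt -lt_col_len -leqNgt.
Qed.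

(** Overwriting column [j] with the same [z] forgets it, so the fiber consists of the plane
    partitions that agree with [P0] off column [j]; the admissible columns [t] parametrize it. *)
Lemma agreements_step_fiber (R : comNzRingType) (x : R) P0 z :
  P0 \in PP la m ->
  let fiber P := (P \in PP la m) && (set_col P z == set_col P0 z) in
  (\sum_(P | fiber P) x ^+ agreements j P =
   \sum_(P | fiber P) x ^+ agreements j.+1 P)%R.
Proof.
move=> P0_PP fiber.
have reindex_fiber (F : filling la m -> R) :
    (\sum_(P | fiber P) F P =
     \sum_(t : col_len.-tuple 'I_m.+1 |
           between (lentry P0 ^~ j) (entry P0 ^~ j.+1) m (map val t))
       F (set_col P0 t))%R.
  rewrite (reindex_onto (set_col P0) get_col) => [|P /andP[_ /eqP eqP0]].
    apply: eq_bigl => t; rewrite /fiber get_set_col eqxx andbT.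
    by rewrite set_set_col eqxx andbT set_col_PP.
  by rewrite -(set_set_col P0 z) -eqP0 set_set_col set_get_col.
have [Hr Hc] := PP_entryP P0 P0_PP.
rewrite !reindex_fiber.
(* The rows that miss column [j] contribute a constant factor; the others give a column sum. *)
have factor k (f : nat -> nat) :
    (forall t i, (entry (set_col P0 t) i k == lentry (set_col P0 t) i k) =
       (nth 0 (map val t) i == f i)) -> j <= k <= j.+1 ->
  (\sum_(t : col_len.-tuple 'I_m.+1 |
           between (lentry P0 ^~ j) (entry P0 ^~ j.+1) m (map val t))
       x ^+ agreements k (set_col P0 t) =
   column_sum x col_len f (lentry P0 ^~ j) (entry P0 ^~ j.+1) m *
   x ^+ fixed_agreements P0)%R.
  move=> Hf Hk; rewrite -(column_sumE _ _ _ _ _ (leqnn m)) big_distrl /=.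
  apply: eq_bigr => t _; rewrite agreements_split // fixed_agreements_set_col.
  by rewrite exprD; congr (_ ^+ _ * _)%R; apply: eq_bigr => i _; rewrite Hf.
(* Statistic [j] compares the varying column with its left neighbour, statistic [j + 1] with its
   right neighbour. *)
rewrite (factor j (lentry P0 ^~ j)); first last.
- by rewrite leqnn leqnSn.
- by move=> t i; rewrite entry_set_col eqxx lentry_set_col.
rewrite (factor j.+1 (entry P0 ^~ j.+1)); first last.
- by rewrite leqnn leqnSn.
- by move=> t i; rewrite /= !entry_set_col eqxx (gtn_eqF (ltnSn j)) eq_sym.
congr (_ * _)%R; apply: column_sum_sym => [i|i|i|].
- by case: (j) => //= j'; apply: Hc.
- exact: Hc.
- by case: (j) => [|j'] /=; [apply: entry_le | apply: leq_trans (Hr _ _) _].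
- exact: lentry_le.
Qed.

Lemma agreements_step (R : comNzRingType) (x : R) :
  (\sum_(P in PP la m) x ^+ agreements j P =
   \sum_(P in PP la m) x ^+ agreements j.+1 P)%R.
Proof.
(* An arbitrary placeholder: the overwritten filling need not be a plane partition, hence the
   partition over all fillings. *)
set z := [tuple ord0 | _ < col_len] : col_len.-tuple 'I_m.+1.
rewrite (partition_big (fun P => set_col P z) predT) //=.
rewrite [RHS](partition_big (fun P => set_col P z) predT) //=.
apply: eq_bigr => Q _.
have [P0 /andP[P0_PP /eqP <-] | no_P0] :=
  pickP (fun P => (P \in PP la m) && (set_col P z == Q)).
  exact: agreements_step_fiber.
by rewrite !big_pred0.
Qed.

End ReplaceColumn.

End Cells.

(** * From rows containing 0 to rows containing [m] *)

Local Open Scope ring_scope.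

Theorem theorem1p1 (la : seq nat) (m : nat) (hla : is_partition la) :
  \sum_(P in PP la m) 'X^(rows_containing 0 P)
    = \sum_(P in PP la m) 'X^(rows_containing m P) :> {poly int}.
Proof.
have le_la0 i : (nth 0 la i <= nth 0 la 0)%N.
  exact: (noninc_le (la_noninc hla)).
under eq_bigr => P P_PP do rewrite (agreements_last hla le_la0 P_PP).
under [RHS]eq_bigr => P P_PP do rewrite (agreements_first hla P_PP).
(* The statistic descends one column at a time from the length of the longest row to 0. *)
elim: (nth 0%N la 0) => // j <-.
by rewrite -agreements_step.
Qed.
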